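(* For every $C, \varepsilon > 0$ there exists $\delta = \delta(C,\varepsilon) > 0$ so that for every collection of finite sets $S_1,\ldots,S_k$ with at least two elements each, the following holds. If $\mathcal{A}$ is a minimal cover of $S_{[k]}$ with hyperplanes such that $F(\mathcal{A}) = [k]$ and $$|\mathcal{A}| \leq C \sum_{i=1}^k \big( |S_i| - 1 \big),$$ then $\mathcal{A}$ contains a $\delta$-generalized frame $(\mathcal{F}_1,\ldots,\mathcal{F}_k)$ with $$\sum_{i=1}^k |\mathcal{F}_i| \geq (1 - \varepsilon) \sum_{i=1}^k \big( |S_i| - 1 \big).$$
   Context: Let $S_1,\ldots,S_k$ be finite sets, each with at least two elements, and write $[k]=\{1,\dots,k\}$ and $S_I := \prod_{i \in I} S_i$ for $I \subseteq [k]$. A hyperplane in $S_{[k]}$ is a set $H = H_1 \times \cdots \times H_k$ with each $H_i$ either equal to $S_i$ or a singleton subset of $S_i$. Write $F(H) := \{ i \in [k] : |H_i| = 1 \}$ for the set of fixed coordinates of $H$, and $F(\mathcal{A}) := \bigcup_{H \in \mathcal{A}} F(H)$ for a collection $\mathcal{A}$ of hyperplanes. A collection $\mathcal{A}$ of hyperplanes is a minimal cover of $S_{[k]}$ if its union is $S_{[k]}$ and no proper subcollection has union $S_{[k]}$. For $I \subseteq [k]$ write $H_I := \prod_{i \in I} H_i$, and $\mu_I(H) := |H_I|\cdot|S_I|^{-1}$ if $I \neq \emptyset$, and $\mu_\emptyset(H) := 1$. Simple $\delta$-generalized frame ($\delta>0$): a sequence $(\mathcal{F}_1,\ldots,\mathcal{F}_k)$,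 where $\mathcal{F}_i$ is a collection of at most $|S_i|-1$ hyperplanes in $S_{[k]}$, such that for each $i \in [k]$ there exist a set $I(i) \subseteq [k]$ with $I(i) \supseteq \{i+1,\ldots,k\}$ and, for each $j \in [k] \setminus (I(i) \cup \{i\})$, an element $s_j(i) \in S_j$, such that for each $H \in \mathcal{F}_i$: $i \in F(H)$; $\mu_{I(i)}(H) > \delta$; and $H_j \in \{ \{s_j(i)\}, S_j \}$ for every $j \in [k] \setminus (I(i) \cup \{i\})$. Moreover, if $\min\{|S_i|,|S_j|\} \ge \delta^{-1}$ and $i \neq j$, then $\mathcal{F}_i$ and $\mathcal{F}_j$ are disjoint. A $\delta$-generalized frame is obtained from a simple $\delta$-generalized frame by permuting the sets $S_1,\ldots,S_k$; that is, the same conditions hold with the requirement $I(i) \supseteq \{i+1,\dots,k\}$ replaced by: there is a permutation $\pi$ of $[k]$ with $I(\pi(i)) \supseteq \{\pi(i+1),\ldots,\pi(k)\}$ for each $i \in [k]$. The collection $\mathcal{A}$ contains $(\mathcal{F}_1,\ldots,\mathcal{F}_k)$ if $\mathcal{F}_i \subseteq \mathcal{A}$ for every $i$. *)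

(* Defs.v *)
From HB Require Import structures.
From mathcomp Require Import all_boot all_order all_algebra perm.
From mathcomp Require Import reals.
Set Implicit Arguments.
Unset Strict Implicit.
Unset Printing Implicit Defensive.
Import Order.TTheory GRing.Theory Num.Theory.
Local Open Scope ring_scope.

Section Hyperplanes.
Context {k : nat} {S : 'I_k -> finType}.

(* Index sets are 0-based: ['I_k] plays the role of [k]. *)
Definition space : finType := {dffun forall i : 'I_k, S i}.

Definition is_hyperplane (H : {dffun forall i : 'I_k, {set S i}}) : bool :=
  [forall i, (H i == [set: S i]) || (#|H i| == 1)%N].

(* A hyperplane H_1 x ... x H_k is represented by its tuple of factors. When
   the S_i are nonempty so are the factors, and the product then determines
   them (hyperplane_set_inj below): collections of hyperplanes as tuples and
   as subsets of the space are the same thing. *)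
Definition hyperplane : finType :=
  {H : {dffun forall i : 'I_k, {set S i}} | is_hyperplane H}.

Definition factor (H : hyperplane) (i : 'I_k) : {set S i} := val H i.

Definition hyperplane_set (H : hyperplane) : {set space} := setXn (factor H).

Definition fixed_coords (H : hyperplane) : {set 'I_k} :=
  [set i | #|factor H i| == 1%N].

Definition fixed_coords_of (A : {set hyperplane}) : {set 'I_k} :=
  \bigcup_(H in A) fixed_coords H.

Definition is_cover (A : {set hyperplane}) : bool :=
  \bigcup_(H in A) hyperplane_set H == [set: space].

Definition is_minimal_cover (A : {set hyperplane}) : bool :=
  is_cover A && [forall B : {set hyperplane}, (B \proper A) ==> ~~ is_cover B].

Definition subspace (I : {set 'I_k}) : finType :=
  {dffun forall i : {i : 'I_k | i \in I}, S (val i)}.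

Definition hyperplane_proj (I : {set 'I_k}) (H : hyperplane) :
    {set subspace I} :=
  setXn (fun i : {i : 'I_k | i \in I} => factor H (val i)).

(* For I empty both cardinals are 1, in accordance with the convention that
   the density is then 1. *)
Definition density (R : realType) (I : {set 'I_k}) (H : hyperplane) : R :=
  #|hyperplane_proj I H|%:R / #|subspace I|%:R.

(* The set I i may contain i. The points s i j matter only for j outside
   i |: I i; taking s total is harmless since the S_j are nonempty. *)
Definition generalized_frame (R : realType) (delta : R)
    (F : 'I_k -> {set hyperplane}) : Prop :=
  (forall i, (#|F i| <= #|S i| - 1)%N) /\
  (exists (pi : 'S_k) (I : 'I_k -> {set 'I_k}) (s : forall i j : 'I_k, S j),
     (forall i j : 'I_k, (i < j)%N -> pi j \in I (pi i)) /\
     (forall (i : 'I_k) (H : hyperplane), H \in F i ->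
        [/\ i \in fixed_coords H,
            delta < density R (I i) H
          & forall j, j \notin i |: I i ->
              factor H j = [set s i j] \/ factor H j = [set: S j]])) /\
  (forall i j : 'I_k, i != j -> delta^-1 <= (minn #|S i| #|S j|)%:R ->
     [disjoint F i & F j]).

Lemma hyperplane_set_inj :
  (forall i, 0 < #|S i|)%N -> injective hyperplane_set.
Proof.
move=> S_gt0.
have factor_neq0 (H : hyperplane) i : exists x, x \in factor H i.
  apply/set0Pn; rewrite -card_gt0.
  have /forallP/(_ i)/orP[/eqP E | /eqP E] := valP H.
    by rewrite /factor E cardsT S_gt0.
  by rewrite /factor E.
suff sub (H K : hyperplane) i : hyperplane_set H = hyperplane_set K ->
    factor H i \subset factor K i.
  move=> H K E; apply: val_inj; apply/ffunP => i.
  by apply/eqP; rewrite eqEsubset !sub.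
move=> E; apply/subsetP => x xH.
pose h j := xchoose (factor_neq0 H j).
pose p : space := [ffun j => dfwith h x j].
have /setXnP/(_ i) : p \in hyperplane_set K.
  rewrite -E; apply/setXnP => j; rewrite ffunE.
  by case: dfwithP => // j' _; apply: xchooseP.
by rewrite ffunE dfwith_in.
Qed.

Lemma density0 (R : realType) (H : hyperplane) : density R set0 H = 1.
Proof.
have E (i : {i : 'I_k | i \in set0}) : False by case: i => i; rewrite inE.
have setXn1 (B : forall i : {i : 'I_k | i \in set0}, {set S (val i)}) :
    #|setXn B| = 1%N by rewrite cardsXn big1 // => i; case: (E i).
have subspace1 : #|subspace set0| = 1%N.
  rewrite -cardsT -(setXn1 (fun i => [set: S (val i)])).
  congr #|pred_of_set _|; apply/setP => x; rewrite in_setXn inE.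
  by apply/esym/forallP => i; case: (E i).
by rewrite /density setXn1 subspace1 divr1.
Qed.

End Hyperplanes.

Arguments space {k} S.
Arguments hyperplane {k} S.

(* Main.v *)
Require Import Defs.
From mathcomp Require Import all_boot all_order all_algebra.
From mathcomp Require Import reals.
From mathcomp Require Import perm zify lra.
Import Order.TTheory GRing.Theory Num.Theory.
Local Open Scope ring_scope.

(** The frame is built coordinate by coordinate, in the order of the final
permutation.  At any moment some set Q of coordinates has been dealt with and
frozen at the values of a point x, and B is a minimal cover of the fibre of x
over Q; U is the set of coordinates outside Q that B still fixes.  Call a value
b of a coordinate i in U
- thick if some H in B has H_i = {b} and large density in U minus i,
- popular if it is not thick but at least K members of B have H_i = {b},
- poor otherwise.
One thick hyperplane for each thick value makes an admissible F_i, so what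
i loses is accounted for by its popular and poor values.

Some i in U has at most 1 + (|S_i| - 1) / e poor values
([exists_good_coordinate]).  Otherwise restrict every i in U to its poor
values: fewer than K hyperplanes sit over each value that is left, all of them
are thin, and a counting form of the Lovasz local lemma ([exists_escape]) gives
a point of the fibre that nothing covers.

Take such an i next.  The fibres over Q and i are then covered by subfamilies
of B: choose a point z that extends x, take a minimal cover B_1 of its fibre,
freeze the coordinates U_1 fixed by B_1, choose by minimality of B a point not
yet covered, and so on.  The families B_1, B_2, ... are disjoint and the sets
U_1, U_2, ... partition U minus i.  Members of B_t fix nothing outside U_t and
the coordinates frozen before, so a density measured in U_t is the density with
respect to all later coordinates.  Recursion applies to each B_t.

The loss is controlled by the potential max(|B| - K, 0): K times the part of
the loss due to popular values is at most this potential.  To pass from the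
B_t to B, send each member of B_t to the common value at i of the points of its
fibre, and every other member to a value of its own factor at i.  The potential
is superadditive, and each value b receiving at least K members gains an extra
K ([sum_sub_le]).  All popular values gain.  If there is a poor value a, choose
z with z_i = a: then a gains as well, because a cover with fewer than K members
has only thick members ([poor_fiber_large]).  This pays for the K that the
potential of B subtracts.  If there is none, the thick and popular values exceed
|S_i| - 1 by one, so one popular value costs nothing, to the same effect.

Altogether the loss is at most w / e + |A| / K with w the sum of the |S_i| - 1,
which is at most eps w when e and K are large in terms of eps and C. *)

(** * Hyperplanes and points *)

Section Covers.
Local Set Implicit Arguments.
Local Unset Strict Implicit.
Local Unset Printing Implicit Defensive.
Local Open Scope nat_scope.

Context {k : nat} {S : 'I_k -> finType}.
Local Notation space := Defs.space.
Implicit Types (i j : 'I_k) (x z w : space S) (H : hyperplane S).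
Implicit Types (B : {set hyperplane S}) (P Q U V : {set 'I_k}).

Lemma factorP H i : factor H i = [set: S i] \/ i \in fixed_coords H.
Proof.
have /forallP/(_ i)/orP[/eqP E | E] := valP H; first by left.
by right; rewrite inE.
Qed.

Lemma factor_fixed H i b :
  i \in fixed_coords H -> b \in factor H i -> factor H i = [set b].
Proof. by rewrite inE => /cards1P[c ->] /set1P->. Qed.

Lemma mem_factor_free H i b : i \notin fixed_coords H -> b \in factor H i.
Proof. by case: (factorP H i) => [-> | ->]. Qed.

Lemma mem_hyperplane H z :
  reflect (forall i, i \in fixed_coords H -> z i \in factor H i)
          (z \in hyperplane_set H).
Proof.
apply: (iffP setXnP) => zH i; first by move=> _; apply: zH.
case: (boolP (i \in fixed_coords H)) => [/zH // | ].
exact: mem_factor_free.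
Qed.

Lemma leq_card_bigcup (I T : finType) (A : pred I) (F : I -> {set T}) :
  #|\bigcup_(i | A i) F i| <= \sum_(i | A i) #|F i|.
Proof.
elim/big_rec2: _ => [|i n X _ le_X]; first by rewrite cards0.
by apply: leq_trans (leq_card_setU _ _) _; rewrite leq_add2l.
Qed.

Definition splice V z x : space S := [ffun j => if j \in V then z j else x j].

Definition update x i (b : S i) : space S := [ffun j => dfwith x b j].

Lemma update_at x i (b : S i) : update x b i = b.
Proof. by rewrite ffunE dfwith_in. Qed.

Lemma update_off x i (b : S i) j : j != i -> update x b j = x j.
Proof. by move=> ji; rewrite ffunE dfwith_out // eq_sym. Qed.

(** * A counting form of the local lemma *)

Section Counting.

Context (x : space S) (M : forall i, {set S i}) (B : {set hyperplane S}).
Context (U : {set 'I_k}) (K : nat).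

(** Only the coordinates of V are free, the others being pinned to x, and only
the hyperplanes whose constraints within U are already decided by V have to be
avoided.  Growing V from the empty set to U leads to a point avoiding B. *)
Definition escapes V : {set space S} :=
  [set z : space S | [forall j, if j \in V then z j \in M j else z j == x j] &&
           [forall H in B, (fixed_coords H :&: U \subset V) ==>
              (z \notin hyperplane_set H)]].

Lemma escapesP V z :
  reflect [/\ forall j, j \in V -> z j \in M j,
              forall j, j \notin V -> z j = x j
            & forall H, H \in B -> fixed_coords H :&: U \subset V ->
                z \notin hyperplane_set H]
          (z \in escapes V).
Proof.
rewrite inE; apply: (iffP andP) => [[/forallP zV /forall_inP zB] | [zV z'V zB]].
  split=> [j Vj | j V'j | H BH]; last by apply/implyP/zB.
    by have := zV j; rewrite Vj.
  by apply/eqP; have := zV j; rewrite (negbTE V'j).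
split; last by apply/forall_inP=> H BH; apply/implyP/zB.
apply/forallP=> j; case: ifP => [/zV // | /negbT/z'V ->]; exact: eqxx.
Qed.

(** Candidates for [escapes (i |: V)]: their value at i is free in M i, and
resetting it gives an element of [escapes V]. *)
Definition extensions V i : {set space S} :=
  [set w : space S | (w i \in M i) && (update w (x i) \in escapes V)].

Lemma card_extensions V i :
  i \notin V -> #|M i| * #|escapes V| <= #|extensions V i|.
Proof.
move=> V'i; pose f (p : S i * space S) := update p.2 p.1.
have f_inj : {in setX (M i) (escapes V) &, injective f}.
  move=> [b z] [c w] /setXP[/= _ /escapesP[_ zx _]].
  move=> /setXP[/= _ /escapesP[_ wx _]].
  rewrite /f /= => E.
  have -> : b = c by rewrite -(update_at z b) E update_at.
  congr pair; apply/ffunP=> j; case: (eqVneq j i) => [-> | ji].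
    by rewrite zx // wx.
  by rewrite -(update_off z b ji) E update_off.
rewrite -cardsX -(card_in_imset f_inj); apply/subset_leq_card/subsetP=> w.
case/imsetP=> [[b z] /setXP[/= Mb Ez] ->].
rewrite inE /f /= update_at Mb.
suff -> : update (update z b) (x i) = z by [].
have [_ zx _] := escapesP _ _ Ez.
apply/ffunP=> j; case: (eqVneq j i) => [-> | ji]; last by rewrite !update_off.
by rewrite update_at zx.
Qed.

(** A candidate that lies on H is determined by its values at the coordinates
that H does not fix.  Pinning the fixed ones to x gives an escaping point for
the rest of V, since hyperplanes decided there do not see the change. *)
Lemma card_extensions_hit V i H :
  H \in B -> V \subset U -> i \in U -> i \notin V -> i \in fixed_coords H ->
  fixed_coords H :&: U \subset i |: V ->
  #|[set w in extensions V i | w \in hyperplane_set H]|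
    <= #|escapes (V :\: fixed_coords H)|.
Proof.
move=> BH VU Ui V'i Hi HV; set W := [set w in _ | _].
pose f w := splice (fixed_coords H) x w.
have out w j : update w (x i) \in escapes V -> j \notin V -> j != i -> w j = x j.
  by case/escapesP=> _ wx _ V'j ji; rewrite -wx // update_off.
have f_inj : {in W &, injective f}.
  move=> w w' /setIdP[/setIdP[_ Ew] /mem_hyperplane Hw].
  move=> /setIdP[/setIdP[_ Ew'] /mem_hyperplane Hw'] E; apply/ffunP=> j.
  case: (boolP (j \in fixed_coords H)) => [Hj | H'j].
    by apply/set1P; rewrite -(factor_fixed Hj (Hw' _ Hj)) Hw.
  by have /ffunP/(_ j) := E; rewrite !ffunE (negbTE H'j).
rewrite -(card_in_imset f_inj); apply/subset_leq_card/subsetP=> _ /imsetP[w + ->].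
case/setIdP=> /setIdP[Mw Ew] /mem_hyperplane Hw.
have [EM Ex EB] := escapesP _ _ Ew.
have off j : j \notin fixed_coords H -> f w j = update w (x i) j.
  move=> H'j; rewrite ffunE (negbTE H'j) update_off //.
  by apply: contraNneq H'j => ->.
apply/escapesP; split=> [j /setDP[Vj H'j] | j | H' BH' H'V].
- by rewrite off // EM.
- rewrite inE negb_and negbK => /orP[Hj | V'j]; first by rewrite ffunE Hj.
  case: (boolP (j \in fixed_coords H)) => [Hj | H'j]; first by rewrite ffunE Hj.
  by rewrite off // Ex.
have /EB : fixed_coords H' :&: U \subset V.
  exact: subset_trans H'V (subsetDl _ _).
move=> /(_ BH'); apply: contra => /mem_hyperplane Hf; apply/mem_hyperplane=> j H'j.
case: (boolP (j \in U)) => [Uj | U'j].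
  have: j \in fixed_coords H' :&: U by rewrite inE H'j.
  by move=> /(subsetP H'V)/setDP[_ nHj]; rewrite -off ?Hf.
have ji : j != i by apply: contraNneq U'j => ->.
have V'j : j \notin V by apply: contra U'j; apply: subsetP.
by have := Hf j H'j; rewrite ffunE update_off //; case: ifP => //; rewrite (out w).
Qed.

(** Without denominators, [thin] says that the product of the (2 / 3) |M j| is
at least 3 K; 2 / 3 is the proportion of extensions that survive at each step
of [escapes_growth]. *)
Hypothesis M_gt0 : forall i, i \in U -> 0 < #|M i|.
Hypothesis few : forall i b, i \in U -> b \in M i ->
  #|[set H in B | factor H i == [set b]]| <= K.
Hypothesis thin : forall i b H, i \in U -> b \in M i -> H \in B ->
  factor H i = [set b] ->
  3 * K * 3 ^ #|(fixed_coords H :&: U) :\ i| <=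
    \prod_(j in (fixed_coords H :&: U) :\ i) (2 * #|M j|).
Hypothesis hitU : forall H, H \in B -> fixed_coords H :&: U != set0.

(** Instead of bounding conditional probabilities, compare numbers of partial
solutions.  Of the |M i| |escapes V| candidates, those on a given H number at
most |escapes (V minus H)|, which by induction is smaller than |escapes V| by
the product of the (2 / 3) |M j|, hence by 3 K.  There are at most K |M i|
relevant H, so at least two thirds of the candidates survive. *)
Lemma escapes_growth V i : V \subset U -> i \in U -> i \notin V ->
  2 * #|M i| * #|escapes V| <= 3 * #|escapes (i |: V)|.
Proof.
have [n] := ubnP #|V|; elim: n V i => // n IHn V i ltVn VU Ui V'i.
(* Iterating the induction hypothesis over the elements of T. *)
have tower (T : {set 'I_k}) : T \subset V ->
    (\prod_(j in T) (2 * #|M j|)) * #|escapes (V :\: T)| <= 3 ^ #|T| * #|escapes V|.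
  have [m] := ubnP #|T|; elim: m T => // m IHm T ltTm TV.
  have [-> | [t Tt]] := set_0Vmem T.
    by rewrite big_set0 cards0 setD0 expn0.
  have Vt := subsetP TV _ Tt.
  rewrite (big_setD1 t Tt) /= (cardsD1 t) Tt expnS.
  have step : 2 * #|M t| * #|escapes (V :\: T)| <= 3 * #|escapes (V :\: (T :\ t))|.
    have -> : V :\: (T :\ t) = t |: (V :\: T).
      by apply/setP=> j; rewrite !inE; case: eqVneq => [-> | _] //=; rewrite Vt.
    apply: IHn; [|  | exact: subsetP VU _ Vt | by rewrite inE Tt].
      have: V :\: T \proper V.
        by apply/properP; split; [exact: subsetDl | exists t; rewrite // inE Tt].
      by move/proper_card; lia.
    exact: subset_trans (subsetDl _ _) VU.
  have sub : T :\ t \subset V by exact: subset_trans (subsetDl _ _) TV.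
  have := IHm (T :\ t) _ sub.
  have -> : #|T :\ t| < m by move: ltTm; rewrite (cardsD1 t T) Tt.
  move=> /(_ isT); set p := \prod_(j in _) _; set a := #|escapes _| in step *.
  set b := #|escapes _| in step *; set c := #|escapes V|; set e := 3 ^ _.
  by move=> pb; nia.
pose bad := [set H in B | (i \in fixed_coords H) && (factor H i \subset M i)
                          && (fixed_coords H :&: U \subset i |: V)].
have cover : extensions V i \subset escapes (i |: V) :|:
    \bigcup_(H in bad) [set w in extensions V i | w \in hyperplane_set H].
  apply/subsetP=> w Ew; rewrite inE.
  have [wE | /= nwE] := boolP (w \in escapes (i |: V)) => //=.
  have /setIdP[Mw /escapesP[EM Ex EB]] := Ew.
  have: ~~ [forall H in B, (fixed_coords H :&: U \subset i |: V) ==>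
              (w \notin hyperplane_set H)].
    apply: contra nwE => wB; apply/setIdP/andP; rewrite wB andbT; apply/forallP=> j.
    rewrite in_setU1; case: (eqVneq j i) => [-> // | ji] /=.
    case: ifP => [Vj | /negbT V'j]; first by rewrite -(update_off w (x i) ji) EM.
    by rewrite -(update_off w (x i) ji) Ex.
  rewrite negb_forall_in => /exists_inP[H BH]; rewrite negb_imply negbK.
  move=> /andP[HV wH]; apply/bigcupP; exists H; last exact/setIdP.
  have zH := mem_hyperplane _ _ wH.
  suff Hi : i \in fixed_coords H.
    by rewrite inE BH Hi HV (factor_fixed Hi (zH i Hi)) sub1set Mw.
  apply: contraLR wH => H'i.
  have HV' : fixed_coords H :&: U \subset V.
    apply/subsetP=> j Hj; have := subsetP HV j Hj; rewrite in_setU1.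
    by case: eqVneq Hj => // ->; rewrite inE (negbTE H'i).
  apply: contra (EB H BH HV') => _; apply/mem_hyperplane=> j Hj.
  by rewrite update_off ?zH //; apply: contraNneq H'i => <-.
have bound : #|extensions V i| <= #|escapes (i |: V)| +
    \sum_(H in bad) #|escapes (V :\: fixed_coords H)|.
  apply: leq_trans (subset_leq_card cover) _.
  apply: leq_trans (leq_card_setU _ _) _; rewrite leq_add2l.
  apply: leq_trans (leq_card_bigcup _ _) _ => /=.
  apply: leq_sum => H; rewrite inE => /andP[BH /andP[/andP[Hi _] HV]].
  exact: card_extensions_hit.
have card_bad : #|bad| <= #|M i| * K.
  have -> : bad = bad :&: \bigcup_(b in M i) [set H in B | factor H i == [set b]].
    apply/esym/setIidPl/subsetP=> H; rewrite inE => /andP[BH /andP[/andP[]]].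
    rewrite inE => /cards1P[b E]; rewrite E sub1set => Mb _.
    by apply/bigcupP; exists b; rewrite // inE BH E eqxx.
  apply: leq_trans (subset_leq_card (subsetIr _ _)) _.
  apply: leq_trans (leq_card_bigcup _ _) _.
  by rewrite -sum_nat_const; apply: leq_sum => b; apply: few.
have hits : \sum_(H in bad) 3 * K * #|escapes (V :\: fixed_coords H)|
    <= #|bad| * #|escapes V|.
  rewrite -sum_nat_const; apply: leq_sum => H.
  case/setIdP=> BH /andP[/andP[Hi Hsub] HV].
  have [b Eb] : exists b, factor H i = [set b].
    by move: Hi; rewrite inE => /cards1P.
  have Mb : b \in M i by rewrite -sub1set -Eb.
  have := thin Ui Mb BH Eb; set T := _ :\ i => thinT.
  have TV : T \subset V.
    apply/subsetP=> j /setD1P[ji Hj]; have := subsetP HV j Hj.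
    by rewrite in_setU1 (negbTE ji).
  have -> : V :\: fixed_coords H = V :\: T.
    apply/setP=> j; rewrite !inE; case: (boolP (j \in V)); rewrite ?andbF //= => Vj.
    rewrite (subsetP VU _ Vj) !andbT.
    by have -> : j != i by apply: contraNneq V'i => <-.
  have := tower T TV; have : 0 < 3 ^ #|T| by rewrite expn_gt0.
  move: thinT; set p := \prod_(j in _) _; set a := #|escapes _|.
  set c := #|escapes V|; set e := 3 ^ _; move=> *.
  by rewrite -(leq_pmul2l (m := e)) //; nia.
move: hits; rewrite -big_distrr /=; move: bound card_bad (card_extensions V'i).
have [->| K_gt0] := posnP K.
  rewrite muln0 leqn0 cards_eq0 => /[swap]/eqP->; rewrite big_set0 addn0.
  move=> le1 le2 _; have := leq_trans le2 le1; rewrite -mulnA.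
  by set p := #|M i| * _; set c := #|_|; lia.
set s := \sum_(H in _) _; set a := #|escapes V|; set b := #|escapes _|.
set m := #|M i|; set q := #|bad|; move=> h1 h2 h3 h4.
have h5 : 3 * K * s <= m * K * a by apply: leq_trans h4 _; rewrite leq_mul2r h2 orbT.
have h6 : 3 * s <= m * a by rewrite -(leq_pmul2l K_gt0); lia.
by lia.
Qed.

Lemma exists_escape :
  exists z, [/\ forall j, j \in U -> z j \in M j,
                forall j, j \notin U -> z j = x j
              & forall H, H \in B -> z \notin hyperplane_set H].
Proof.
have pos V : V \subset U -> 0 < #|escapes V|.
  have [n] := ubnP #|V|; elim: n V => // n IHn V ltVn VU.
  have [-> | [i Vi]] := set_0Vmem V.
    apply/card_gt0P; exists x; apply/escapesP; split=> [j | // | H BH].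
      by rewrite inE.
    by rewrite subset0 (negbTE (hitU BH)).
  have VU' : V :\ i \subset U by exact: subset_trans (subsetDl _ _) VU.
  have Ui := subsetP VU _ Vi.
  have := escapes_growth VU' Ui (negbT (setD11 i V)); rewrite setD1K //.
  have : 0 < #|escapes (V :\ i)|.
    by apply: IHn VU'; move: ltVn; rewrite (cardsD1 i) Vi.
  have := M_gt0 Ui; set m := #|M i|; set a := #|_|; set c := #|_|.
  by case: c; nia.
have /card_gt0P[z /escapesP[zM zx zB]] := pos U (subxx _).
by exists z; split=> // H BH; apply: zB BH (subsetIr _ _).
Qed.

End Counting.
(** * Minimal covers of fibres *)

Definition agree Q x z : bool := [forall j in Q, z j == x j].

Definition covers_fiber Q x B : bool :=
  [forall z : space S, agree Q x z ==> [exists H in B, z \in hyperplane_set H]].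

Lemma agreeP Q x z : reflect (forall j, j \in Q -> z j = x j) (agree Q x z).
Proof. by apply: (iffP forall_inP) => E j /E/eqP. Qed.

Lemma covers_fiberP Q x B :
  reflect (forall z, agree Q x z -> exists2 H, H \in B & z \in hyperplane_set H)
          (covers_fiber Q x B).
Proof.
apply: (iffP forallP) => cov z.
  by move=> Ez; have /implyP/(_ Ez)/exists_inP := cov z.
by apply/implyP=> /cov Hz; apply/exists_inP.
Qed.

Lemma covers_fiberS P Q x z B :
  P \subset Q -> agree P x z -> covers_fiber P x B -> covers_fiber Q z B.
Proof.
move=> PQ /agreeP zx /covers_fiberP cov; apply/covers_fiberP=> w /agreeP wz.
by apply/cov/agreeP=> j Pj; rewrite wz ?zx ?(subsetP PQ).
Qed.

Section MinimalFiberCover.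

Context (Q : {set 'I_k}) (x : space S) (B : {set hyperplane S}).
Hypothesis minB : minset (covers_fiber Q x) B.

Lemma private_point H : H \in B ->
  exists z, [/\ agree Q x z, z \in hyperplane_set H
    & forall H', H' \in B -> z \in hyperplane_set H' -> H' = H].
Proof.
move=> BH; have /forallPn[z] : ~~ covers_fiber Q x (B :\ H).
  apply/negP=> cov; have := minsetinf minB cov (subsetDl _ _).
  by move/setP/(_ H); rewrite !inE eqxx BH.
rewrite negb_imply negb_exists_in => /andP[xz /forall_inP zB].
have priv H' : H' \in B -> z \in hyperplane_set H' -> H' = H.
  by move=> BH' zH'; apply: contraTeq zH' => neqH; apply: zB; apply/setD1P.
exists z; split=> //.
have [H' BH' zH'] := covers_fiberP _ _ _ (minsetp minB) z xz.
by rewrite -(priv H' BH' zH').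
Qed.

Lemma base_in_factor H j : H \in B -> j \in Q -> x j \in factor H j.
Proof.
move=> BH Qj; have [z [/agreeP zx /setXnP zH _]] := private_point BH.
by rewrite -zx.
Qed.

Lemma fiber_mem H z : H \in B -> agree Q x z ->
  (forall j, j \in fixed_coords H :\: Q -> z j \in factor H j) ->
  z \in hyperplane_set H.
Proof.
move=> BH /agreeP zx zH; apply/mem_hyperplane=> j Hj.
case: (boolP (j \in Q)) => [Qj | Q'j]; first by rewrite zx // base_in_factor.
by apply: zH; rewrite inE Q'j.
Qed.

(** Such an H contains the whole fibre, so it contains every private point and
is the only member of B. *)
Lemma span_sub H : H \in B -> fixed_coords H \subset Q ->
  fixed_coords_of B \subset Q.
Proof.
move=> BH HQ; apply/bigcupsP=> H' BH'.
have [z [xz zH' priv]] := private_point BH'.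
rewrite -(priv H BH) //; apply: fiber_mem => // j.
by rewrite inE => /andP[Q'j /(subsetP HQ)]; rewrite (negbTE Q'j).
Qed.

(** Move a private point of H to the value b at i: whatever covers the new point
but not the old one must fix i, at b. *)
Lemma value_used H i (b : S i) : H \in B -> i \in fixed_coords H :\: Q ->
  exists2 H', H' \in B & factor H' i = [set b].
Proof.
move=> BH /setDP[Hi Q'i]; have [z [/agreeP zx zH priv]] := private_point BH.
have [-> | zib] := eqVneq b (z i).
  by exists H => //; apply: factor_fixed Hi (mem_hyperplane _ _ zH i Hi).
have [|H' BH' /setXnP upd] := covers_fiberP _ _ _ (minsetp minB) (update z b).
  apply/agreeP=> j Qj; rewrite update_off ?zx //.
  by apply: contraNneq Q'i => <-.
exists H' => //; have := upd i; rewrite update_at => Hb.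
apply: factor_fixed Hb; apply: contraR zib => H'i.
have /(priv _ BH') E : z \in hyperplane_set H'.
  apply/setXnP=> j; have [-> | ji] := eqVneq j i; first exact: mem_factor_free.
  by have := upd j; rewrite update_off.
by move: H'i; rewrite E Hi.
Qed.

Lemma card_value_le H i : H \in B -> i \in fixed_coords H :\: Q -> #|S i| <= #|B|.
Proof.
move=> BH Hi; pose h (b : S i) := odflt H [pick H' in B | factor H' i == [set b]].
have hP b : h b \in B /\ factor (h b) i = [set b].
  rewrite /h; case: pickP => [H' /andP[BH' /eqP] // | none].
  by have [H' BH' E] := value_used b BH Hi; have := none H'; rewrite BH' E eqxx.
have h_inj : injective h.
  by move=> b c E; apply/set1P; rewrite -(hP c).2 -E (hP b).2 set11.
rewrite -cardsT -(card_imset _ h_inj); apply/subset_leq_card/subsetP.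
by move=> _ /imsetP[b _ ->]; have [] := hP b.
Qed.

Hypothesis S_ge2 : forall i, 2 <= #|S i|.

(** Let z be a private point of H.  Changing one coordinate j fixed by H gives
a point on a member of B that misses z, and misses it at j only; so different j
need different members. *)
Lemma card_fixed_le H : H \in B -> #|fixed_coords H :\: Q| <= #|B|.
Proof.
move=> BH; have [z [/agreeP zx /mem_hyperplane zH priv]] := private_point BH.
pose R j H' := (z j \notin factor H' j) &&
  [forall l, (l != j) ==> (z l \in factor H' l)].
pose h j := odflt H [pick H' in B | R j H'].
have hP j : j \in fixed_coords H :\: Q -> h j \in B /\ R j (h j).
  move=> /setDP[Hj Q'j]; rewrite /h; case: pickP => [H' /andP[] // | none].
  have [b zb] : exists b : S j, b != z j.
    have : 0 < #|[set~ z j]| by rewrite cardsC1; have := S_ge2 j; lia.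
    by case/card_gt0P=> b; rewrite !inE; exists b.
  have [|H' BH' /setXnP upd] := covers_fiberP _ _ _ (minsetp minB) (update z b).
    apply/agreeP=> l Ql; rewrite update_off ?zx //.
    by apply: contraNneq Q'j => <-.
  have off l : l != j -> z l \in factor H' l.
    by move=> lj; rewrite -(update_off z b lj).
  suff : R j H' by have := none H'; rewrite BH' /= => ->.
  apply/andP; split; last by apply/forallP=> l; apply/implyP/off.
  apply/negP=> zH'; have E : H' = H.
    apply: priv => //; apply/setXnP=> l; have [-> // | lj] := eqVneq l j.
    exact: off.
  have := upd j; rewrite E update_at (factor_fixed Hj (zH j Hj)).
  by rewrite inE (negbTE zb).
have h_inj : {in fixed_coords H :\: Q &, injective h}.
  move=> j l /hP[_ /andP[zj _]] /hP[_ /andP[_ /forallP/(_ j)/implyP jl]] E.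
  by apply/eqP; apply: contraNT zj => /jl; rewrite E.
rewrite -(card_in_imset h_inj); apply/subset_leq_card/subsetP.
by move=> _ /imsetP[j /hP[Bh _] ->].
Qed.

(** A small minimal cover has only thick members. *)
Lemma prod_card_le H K : H \in B -> #|B| <= K ->
  \prod_(j in fixed_coords H :\: Q) #|S j| <= K ^ K.
Proof.
move=> BH leBK; have K_gt0 : 0 < K.
  by apply: leq_trans leBK; apply/card_gt0P; exists H.
apply: (@leq_trans (\prod_(j in fixed_coords H :\: Q) K)).
  by apply: leq_prod => j /(card_value_le BH)/leq_trans; apply.
rewrite prod_nat_const leq_pexp2l //; exact: leq_trans (card_fixed_le BH) _.
Qed.

End MinimalFiberCover.

(** * A coordinate with few poor values *)

Section GoodCoordinate.

Context (K D e n : nat).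
Hypotheses (S_ge2 : forall i, 2 <= #|S i|) (K_gt0 : 0 < K).
Hypotheses (n_large : 3 ^ n.+1 * e <= 2 * 4 ^ n) (D_large : (3 * K) ^ n.+1 <= D).

Definition thick_value Q B i (b : S i) : bool :=
  [exists H in B, (factor H i == [set b]) &&
     (\prod_(j in (fixed_coords H :\: Q) :\ i) #|S j| < D)].

Definition popularity B i (b : S i) : nat :=
  #|[set H in B | factor H i == [set b]]|.

Definition poor_values Q B i : {set S i} :=
  [set b | ~~ thick_value Q B b && (popularity B b < K)].

(** A polynomial comparison between 2 m / 3 and s, for m at least 2 and at least
s / e: this is what turns thinness with respect to the S_j into thinness with
respect to the sets of poor values. *)
Lemma expn_poor m s : 2 <= m -> s <= e * m -> 3 ^ n.+1 * s <= (2 * m) ^ n.+1.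
Proof.
move=> m2 sm; apply: (@leq_trans (2 * 4 ^ n * m)).
  by rewrite (leq_trans _ (leq_mul n_large (leqnn m))) // -mulnA leq_mul2l sm orbT.
have le4 : 4 ^ n <= (2 * m) ^ n.
  by case: (n) => // n'; rewrite leq_exp2r // (leq_mul2l 2 2).
by rewrite expnS mulnAC leq_mul2l le4 orbT.
Qed.

(** If every i had more than 1 + (|S_i| - 1) / e poor values, the local lemma,
applied to the sets of poor values, would give an uncovered point: at most K
members of B sit over a poor value, and all of them are thin. *)
Lemma exists_good_coordinate Q x B :
  minset (covers_fiber Q x) B -> fixed_coords_of B :\: Q != set0 ->
  exists2 i, i \in fixed_coords_of B :\: Q &
    e * (#|poor_values Q B i| - 1) <= #|S i| - 1.
Proof.
move=> minB U_neq0; set U := _ :\: Q in U_neq0 *.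
pose M := poor_values Q B.
apply/exists_inP; apply: contraT; rewrite negb_exists_in => /forall_inP poorU.
have M_large i : i \in U -> 2 <= #|M i| /\ #|S i| <= e * #|M i|.
  move=> /poorU; rewrite -ltnNge -/(M i); have := S_ge2 i.
  set s := #|S i|; set m := #|M i| => s2 lt.
  have m2 : 2 <= m by move: lt; case: m => [|[|m]] //; rewrite muln0 ltn0.
  by split=> //; nia.
have fixedU H : H \in B -> fixed_coords H :&: U = fixed_coords H :\: Q.
  move=> BH; apply/setP=> j; rewrite in_setI !in_setD.
  case: (boolP (j \in fixed_coords H)); rewrite ?andbF //= => Hj.
  by have -> : j \in fixed_coords_of B by apply/bigcupP; exists H.
have [i /M_large[]|||H BH|z [_ zx zB]] :=
  exists_escape x (M := M) (B := B) (U := U) (K := K).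
- by case: #|M i|.
- by move=> i b _; rewrite inE => /andP[_ /ltnW].
- move=> i b H Ui; rewrite inE negb_exists_in => /andP[/forall_inP thin _] BH E.
  have := thin H BH; rewrite E eqxx /= -leqNgt fixedU // => thinH.
  rewrite -(leq_exp2r _ _ (ltn0Sn n)) expnMn -prod_nat_const.
  have expM N : {morph expn^~ N : a b / a * b} by move=> a c; exact: expnMn.
  rewrite !(big_morph _ (expM n.+1) (exp1n _)).
  apply: leq_trans (leq_mul (leq_trans D_large thinH) (leqnn _)) _.
  rewrite -big_split; apply: leq_prod => j /setD1P[_].
  rewrite -fixedU // => /setIP[_ /M_large[m2 sm]].
  by rewrite /= mulnC; apply: expn_poor.
- rewrite fixedU //; apply: contraNneq U_neq0 => /eqP; rewrite setD_eq0 => HQ.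
  by rewrite setD_eq0; exact: span_sub minB _ BH HQ.
have [|H BH] := covers_fiberP _ _ _ (minsetp minB) z.
  by apply/agreeP=> j Qj; rewrite zx // !inE Qj.
by rewrite (negbTE (zB H BH)).
Qed.

End GoodCoordinate.
(** * Composing frames *)

Lemma subset_of_card (T : finType) (X : {set T}) m :
  m <= #|X| -> exists2 Y : {set T}, Y \subset X & #|Y| = m.
Proof.
move=> le_m; exists [set t in take m (enum X)].
  by apply/subsetP=> t; rewrite inE => /mem_take; rewrite mem_enum.
rewrite cardsE (card_uniqP _) ?take_uniq ?enum_uniq //.
by rewrite size_takel // -cardE.
Qed.

Lemma leq_subD m n p c : m + n <= p -> (m - c) + (n - c) <= p - c.
Proof. by lia. Qed.

Section Framing.

Context (A : {set hyperplane S}) (K D e : nat).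
Implicit Types (F : 'I_k -> {set hyperplane S}) (l : seq 'I_k).

(** The requirements on F_i when Q is the set of coordinates preceding i: the
set I(i) is the complement of Q and i, and x provides the s_j(i).  The density
bound, with threshold 1 / D, is stated without division. *)
Definition frame_piece Q i (X : {set hyperplane S}) : Prop :=
  #|X| <= #|S i| - 1 /\ exists x, forall H, H \in X ->
    [/\ H \in A, i \in fixed_coords H, forall j, j \in Q -> x j \in factor H j
      & \prod_(j in (fixed_coords H :\: Q) :\ i) #|S j| < D].

(** The list l is an order of treatment, and Q holds the coordinates treated
before l, so that frames of consecutive groups are composed by concatenation. *)
Fixpoint framed Q l F : Prop :=
  if l is i :: l' then frame_piece Q i (F i) /\ framed (i |: Q) l' F else True.

Lemma framed_cat Q l1 l2 F :
  framed Q l1 F -> framed (Q :|: [set j in l1]) l2 F -> framed Q (l1 ++ l2) F.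
Proof.
elim: l1 Q => [|i l1 IHl] Q /=; first by rewrite set_nil setU0.
by move=> [pi fl1]; rewrite set_cons setUA [Q :|: _]setUC => /(IHl _ fl1).
Qed.

Lemma eq_framed Q l F F' : {in l, F =1 F'} -> framed Q l F -> framed Q l F'.
Proof.
elim: l Q => //= i l IHl Q eqF [pi /IHl fl].
split; first by rewrite -eqF ?mem_head.
by apply: fl => j lj; rewrite eqF // inE lj orbT.
Qed.

Lemma framed_piece Q l F i : framed Q l F -> i \in l ->
  frame_piece (Q :|: [set j in take (index i l) l]) i (F i).
Proof.
elim: l Q => //= j l IHl Q [pj /IHl fl]; rewrite inE.
case: (eqVneq i j) => [-> _ | ij].
  by rewrite /= set_nil setU0.
by move=> /fl; rewrite /= set_cons setUA [Q :|: _]setUC.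
Qed.

(** The losses |S_j| - 1 - |F_j| are allowed a proportion 1 / e for free; the
number c, measured in hyperplanes, pays for the rest at the price of K per lost
unit. *)
Definition frameable Q (W : {set 'I_k}) (c : nat) : Prop :=
  exists l F, [/\ uniq l, l =i W, framed Q l F &
    e * K * (\sum_(j <- l) (#|S j| - 1 - #|F j|))
      <= K * (\sum_(j <- l) (#|S j| - 1)) + e * c].

Lemma frameable0 Q c : frameable Q set0 c.
Proof. by exists [::], (fun=> set0); split=> // [j|]; rewrite ?inE // big_nil muln0. Qed.

Lemma frameable_leq Q W c c' : c <= c' -> frameable Q W c -> frameable Q W c'.
Proof.
move=> le_c [l [F [Ul lW fl bnd]]]; exists l, F; split=> //.
by apply: leq_trans bnd _; rewrite leq_add2l leq_mul2l le_c orbT.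
Qed.

Lemma frameableU Q (W1 W2 : {set 'I_k}) c1 c2 : [disjoint W1 & W2] ->
  frameable Q W1 c1 -> frameable (Q :|: W1) W2 c2 ->
  frameable Q (W1 :|: W2) (c1 + c2).
Proof.
move=> disW [l1 [F1 [U1 lW1 f1 b1]]] [l2 [F2 [U2 lW2 f2 b2]]].
pose F j := if j \in W1 then F1 j else F2 j.
have eq1 : {in l1, F1 =1 F} by move=> j; rewrite lW1 /F => ->.
have eq2 : {in l2, F2 =1 F}.
  by move=> j; rewrite lW2 /F => W2j; rewrite (disjointFl disW W2j).
exists (l1 ++ l2), F; split.
- rewrite cat_uniq U1 U2 andbT /=; apply/hasPn=> j.
  by rewrite lW2 lW1 /= => W2j; rewrite (disjointFl disW W2j).
- by move=> j; rewrite mem_cat inE lW1 lW2.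
- apply: framed_cat (eq_framed eq1 f1) _; apply: eq_framed eq2 _.
  by have -> : [set j in l1] = W1 by apply/setP=> j; rewrite inE.
have s1 : \sum_(j <- l1) (#|S j| - 1 - #|F j|) =
    \sum_(j <- l1) (#|S j| - 1 - #|F1 j|).
  by apply: eq_big_seq => j /eq1->.
have s2 : \sum_(j <- l2) (#|S j| - 1 - #|F j|) =
    \sum_(j <- l2) (#|S j| - 1 - #|F2 j|).
  by apply: eq_big_seq => j /eq2->.
rewrite !big_cat /= s1 s2; move: (leq_add b1 b2).
by rewrite addnACA -!mulnDr.
Qed.

Lemma frameable1 Q i X p r : frame_piece Q i X ->
  #|S i| - 1 - #|X| <= p + r -> e * r <= #|S i| - 1 -> frameable Q [set i] (K * p).
Proof.
move=> pX loss er; exists [:: i], (fun=> X); split=> // [j|]; first by rewrite !inE.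
rewrite !big_seq1; apply: (@leq_trans (e * K * (p + r))).
  by rewrite leq_mul2l loss orbT.
have := leq_mul (leqnn K) er; set u := K * (#|S i| - 1); nia.
Qed.

Hypothesis S_ge2 : forall i, 2 <= #|S i|.

(** The coordinate i is already frozen, and rho sends each hyperplane to the
value at i that it is charged to.  Taking rho H in the factor of H makes all
hyperplanes with H_i = {b} count for b, wherever the recursion uses them. *)
Definition routed Q B i (rho : hyperplane S -> S i) : Prop :=
  (forall H, rho H \in factor H i) /\
  frameable Q (fixed_coords_of B :\: Q)
    (\sum_b
       (#|[set H in B | ~~ (fixed_coords H \subset Q) && (rho H == b)]| - K)).

(** The members of B1 fix nothing outside Q and the coordinates that B1 treats,
hence are not charged by the rest of the route; they may all be sent to the
value of z at i, and the potential is superadditive. *)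
Lemma routed_step Q z B B1 i (rho : hyperplane S -> S i) :
  i \in Q -> B1 \subset B ->
  minset (covers_fiber Q z) B1 ->
  (forall H, H \in B1 -> ~~ (fixed_coords H \subset Q)) ->
  frameable Q (fixed_coords_of B1 :\: Q) (#|B1| - K) ->
  routed (Q :|: fixed_coords_of B1) B rho ->
  exists2 rho' : hyperplane S -> S i, routed Q B rho' &
    forall H, H \in B1 -> rho' H = z i.
Proof.
move=> Qi B1B minB1 B1Q fr1 [rhoH fr2].
set W1 := _ :\: Q in fr1; set Q2 := _ :|: _ in fr2; set W2 := _ :\: Q2 in fr2.
have Q2E : Q2 = Q :|: W1.
  by apply/setP=> j; rewrite !inE; case: (j \in Q).
have WE : fixed_coords_of B :\: Q = W1 :|: W2.
  have sub : fixed_coords_of B1 \subset fixed_coords_of B.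
    by apply/bigcupsP=> H /(subsetP B1B) BH; apply: (bigcup_sup H).
  apply/setP=> j; rewrite !inE.
  have := subsetP sub j; case: (j \in Q) => //=.
  by case: (j \in fixed_coords_of B1) => // ->.
have dis : [disjoint W1 & W2].
  rewrite -setI_eq0; apply/eqP/setP=> j; rewrite !inE negb_or.
  by case: (j \in Q) => //=; case: (j \in fixed_coords_of B1).
pose rho' H := if H \in B1 then z i else rho H.
exists rho'; last by move=> H B1H; rewrite /rho' B1H.
split.
  by move=> H; rewrite /rho'; case: ifP => // B1H; exact: (base_in_factor minB1).
rewrite WE; apply: frameable_leq (frameableU dis fr1 _); last first.
  by rewrite -Q2E; exact: fr2.
pose f b := #|[set H in B | ~~ (fixed_coords H \subset Q2) && (rho H == b)]|.
have le_f b : f b + (b == z i) * #|B1| <=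
    #|[set H in B | ~~ (fixed_coords H \subset Q) && (rho' H == b)]|.
  set G := [set H in B | ~~ (fixed_coords H \subset Q2) && (rho H == b)].
  have subG : G \subset [set H in B | ~~ (fixed_coords H \subset Q) && (rho' H == b)].
    apply/subsetP=> H /setIdP[BH /andP[HQ2 rb]]; apply/setIdP; split=> //.
    have B1'H : H \notin B1.
      apply: contra HQ2 => B1H; apply: subset_trans (subsetUr _ _).
      exact: (bigcup_sup H).
    rewrite /rho' (negbTE B1'H) rb andbT; apply: contra HQ2 => HQ.
    exact: subset_trans HQ (subsetUl _ _).
  case: (eqVneq b (z i)) => [bz | _]; last by rewrite mul0n addn0 subset_leq_card.
  rewrite mul1n -cardsUI (_ : G :&: B1 = set0) ?cards0 ?addn0.
    apply/subset_leq_card/subsetP=> H /setUP[/(subsetP subG) // | B1H].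
    by rewrite inE (subsetP B1B) //= B1Q // /rho' B1H bz eqxx.
  apply/setP=> H; rewrite inE [RHS]inE.
  apply/negP=> /andP[/setIdP[_ /andP[/negP HQ2 _]] B1H].
  apply: HQ2; apply: subset_trans (subsetUr _ _); exact: (bigcup_sup H).
rewrite [leqLHS]addnC (bigD1 (z i)) //= [leqRHS](bigD1 (z i)) //=.
rewrite -addnA [_ + (#|B1| - K)]addnC addnA; apply: leq_add.
  by apply: leq_subD; have := le_f (z i); rewrite eqxx mul1n.
apply: leq_sum => b /negbTE bz; apply: leq_sub2r.
by have := le_f b; rewrite bz mul0n addn0.
Qed.

Definition framing_below m : Prop := forall Q x B, B \subset A ->
  minset (covers_fiber Q x) B -> #|fixed_coords_of B :\: Q| < m ->
  frameable Q (fixed_coords_of B :\: Q) (#|B| - K).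

(** As long as B fixes a coordinate outside Q, its members fixing only
coordinates of Q form a proper subfamily, so they miss a point z of the fibre.
A minimal cover of the fibre of z over Q then uses none of them, and
[routed_step] applies. *)
Lemma exists_route m P x B Q i : framing_below m ->
  B \subset A -> minset (covers_fiber P x) B -> P \subset Q -> i \in Q ->
  #|fixed_coords_of B :\: Q| < m ->
  exists rho : hyperplane S -> S i, routed Q B rho.
Proof.
move=> IH BA minB; have [p] := ubnP #|fixed_coords_of B :\: Q|.
elim: p Q => // p IHp Q ltQp PQ Qi ltQm.
have [BQ | /set0Pn[j /setDP[Bj Q'j]]] := eqVneq (fixed_coords_of B :\: Q) set0.
  have ex H : exists b, b \in factor H i.
    case: (factorP H i) => [-> | ].
      by have /card_gt0P[b _] := ltnW (S_ge2 i); exists b; rewrite inE.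
    by rewrite inE => /cards1P[b ->]; exists b; rewrite set11.
  exists (fun H => xchoose (ex H)).
  by split=> [H|]; [apply: xchooseP | rewrite BQ; apply: frameable0].
have [z [xz zB]] : exists z, agree P x z /\
    forall H, H \in B -> fixed_coords H \subset Q -> z \notin hyperplane_set H.
  pose BQ := [set H in B | fixed_coords H \subset Q].
  have /forallPn[z] : ~~ covers_fiber P x BQ.
    have BQB : BQ \subset B by apply/subsetP=> H /setIdP[].
    apply/negP=> cov; have E := minsetinf minB cov BQB.
    case/bigcupP: Bj => H; rewrite -E => /setIdP[_ /subsetP HQ] /HQ.
    by rewrite (negbTE Q'j).
  rewrite negb_imply negb_exists_in => /andP[xz /forall_inP zB].
  by exists z; split=> // H BH HQ; apply: zB; apply/setIdP.
have [B1 minB1 B1B] := minset_exists (covers_fiberS PQ xz (minsetp minB)).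
have B1Q H : H \in B1 -> ~~ (fixed_coords H \subset Q).
  move=> B1H; apply/negP=> HQ; have := zB H (subsetP B1B _ B1H) HQ.
  case/negP; apply: (fiber_mem minB1 B1H); first exact/agreeP.
  by move=> l /setDP[/(subsetP HQ)]; move=> ->.
have [|H0 B1H0 _] := covers_fiberP _ _ _ (minsetp minB1) z.
  exact/agreeP.
have sub1 : fixed_coords_of B1 :\: Q \subset fixed_coords_of B :\: Q.
  apply: setSD; apply/bigcupsP=> H /(subsetP B1B) BH; exact: (bigcup_sup H).
have ltU : #|fixed_coords_of B :\: (Q :|: fixed_coords_of B1)| <
    #|fixed_coords_of B :\: Q|.
  apply: proper_card; apply/properP; split; first by apply: setDS; apply: subsetUl.
  have /subsetPn[l Hl Q'l] := B1Q _ B1H0.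
  have B1l : l \in fixed_coords_of B1 by apply/bigcupP; exists H0.
  exists l; last by rewrite !inE B1l orbT.
  by apply: (subsetP sub1); rewrite inE Q'l.
have [||||rho routed_rho] := IHp (Q :|: fixed_coords_of B1).
- exact: leq_trans ltU _.
- exact: subset_trans PQ (subsetUl _ _).
- by rewrite inE Qi.
- exact: ltn_trans ltU _.
have fr1 : frameable Q (fixed_coords_of B1 :\: Q) (#|B1| - K).
  apply: (IH Q z B1) => //; first exact: subset_trans B1B BA.
  by apply: leq_ltn_trans ltQm; apply: subset_leq_card.
by have [rho' ? _] := routed_step Qi B1B minB1 B1Q fr1 routed_rho; exists rho'.
Qed.

End Framing.
(** * Choosing the next coordinate *)

Lemma sum_sub_le (T : finType) (g : T -> nat) c :
  \sum_t (g t - c) + c * #|[set t | c <= g t]| <= \sum_t g t.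
Proof.
have -> : #|[set t | c <= g t]| = \sum_t (c <= g t).
  by rewrite -sum1_card big_mkcond /=; apply: eq_bigr => t _; rewrite inE; case: ifP.
rewrite big_distrr -big_split /=; apply: leq_sum => t _; case: leqP => /=; lia.
Qed.

Section Existence.

Context (A : {set hyperplane S}) (K D e n : nat).
Hypotheses (S_ge2 : forall i, 2 <= #|S i|) (K_gt0 : 0 < K) (D_gt : K ^ K < D).
Hypotheses (n_large : 3 ^ n.+1 * e <= 2 * 4 ^ n) (D_large : (3 * K) ^ n.+1 <= D).

Local Notation thick_value := (thick_value D).
Local Notation poor_values := (poor_values K D).

Definition popular_values Q B i : {set S i} :=
  [set b | ~~ thick_value Q B b && (K <= popularity B b)].

(** If B1 had fewer than K members, all of them would be thick, so none could
fix i, as this would have to be at the value a.  Then B1 would cover the whole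
fibre of x over Q and be equal to B, which does fix i. *)
Lemma poor_fiber_large Q x B B1 i (a : S i) :
  minset (covers_fiber Q x) B -> B1 \subset B -> i \in fixed_coords_of B :\: Q ->
  ~~ thick_value Q B a -> minset (covers_fiber (i |: Q) (update x a)) B1 ->
  K <= #|B1|.
Proof.
move=> minB B1B /setDP[Bi Q'i] not_thick minB1.
rewrite leqNgt; apply/negP=> /ltnW leB1K.
have free H : H \in B1 -> i \notin fixed_coords H.
  move=> B1H; apply/negP=> Hi; case/negP: not_thick; apply/exists_inP.
  exists H; first exact: (subsetP B1B).
  have Ha : a \in factor H i.
    by have := base_in_factor minB1 B1H (setU11 i Q); rewrite update_at.
  rewrite (factor_fixed Hi Ha) eqxx /=.
  apply: leq_ltn_trans D_gt; rewrite setDDl setUC; exact: (prod_card_le minB1 S_ge2).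
have cov : covers_fiber Q x B1.
  apply/covers_fiberP=> z /agreeP xz.
  have [|H B1H /setXnP zH] := covers_fiberP _ _ _ (minsetp minB1) (update z a).
    apply/agreeP=> j /setU1P[-> | Qj]; first by rewrite !update_at.
    have ji : j != i by apply: contraNneq Q'i => <-.
    by rewrite !update_off // xz.
  exists H => //; apply/setXnP=> j; have [-> | ji] := eqVneq j i.
    exact/mem_factor_free/free.
  by rewrite -(update_off z a ji).
have E := minsetinf minB cov B1B.
by case/bigcupP: Bi => H; rewrite -E => /free/negP.
Qed.

(** The piece consists of one thick hyperplane for each thick value, at most
|S_i| - 1 of them. *)
Lemma piece_loss Q x B i : B \subset A -> minset (covers_fiber Q x) B ->
  i \notin Q ->
  exists2 X, frame_piece A D Q i X &
    #|S i| - 1 - #|X| <= #|popular_values Q B i| + #|poor_values Q B i| - 1.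
Proof.
move=> BA minB Q'i; set T := [set b : S i | thick_value Q B b].
pose wit b H := [&& H \in B, factor H i == [set b] &
  \prod_(j in (fixed_coords H :\: Q) :\ i) #|S j| < D].
have [|H0 BH0 _] := covers_fiberP _ _ _ (minsetp minB) x; first exact/agreeP.
pose h b := odflt H0 [pick H | wit b H].
have hP b : b \in T -> wit b (h b).
  rewrite inE => /exists_inP[H BH tH]; rewrite /h; case: pickP => // /(_ H).
  by rewrite /wit BH tH.
have h_inj : {in T &, injective h}.
  move=> b c /hP/and3P[_ /eqP hb _] /hP/and3P[_ /eqP hc _] E.
  by apply/set1P; rewrite -hc -E hb set11.
have [X XT cardX] := subset_of_card (geq_minl #|h @: T| (#|S i| - 1)).
exists X.
  split; first by rewrite cardX geq_minr.
  exists x => H /(subsetP XT)/imsetP[b /hP/and3P[Bh /eqP hb prod_h] ->].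
  split=> // [||j]; [exact: (subsetP BA) | by rewrite inE hb cards1 |].
  exact: (base_in_factor minB).
have part : #|T| + (#|popular_values Q B i| + #|poor_values Q B i|) = #|S i|.
  rewrite -[RHS](cardsC T); congr (_ + _).
  rewrite -cardsUI (_ : _ :&: _ = set0) ?cards0 ?addn0; last first.
    apply/setP=> b; rewrite !inE leqNgt; case: (_ < K); rewrite ?andbF //.
  apply: eq_card => b; rewrite !inE -andb_orr leqNgt orNb andbT //.
rewrite cardX card_in_imset //; move: part; set p := #|_|; set q := #|_|.
by rewrite /minn; case: ifP; lia.
Qed.

(** Treat first a coordinate i with few poor values.  The values that receive
at least K hyperplanes include the popular ones, and a poor one if there is any
because the route starts in its fibre.  They outnumber the p losses that have to
be paid for, since without poor values F_i may omit one value for free. *)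
Lemma framing_below_all m : framing_below A K D e m.
Proof.
elim: m => [|m IH] Q x B BA minB; first by rewrite ltn0.
rewrite ltnS => leUm; have [-> | U_neq0] := eqVneq (fixed_coords_of B :\: Q) set0.
  exact: frameable0.
have [i Ui poor_i] := exists_good_coordinate S_ge2 K_gt0 n_large D_large minB U_neq0.
have [Bi Q'i] := setDP Ui; pose Q' := i |: Q.
have UE : fixed_coords_of B :\: Q = [set i] :|: fixed_coords_of B :\: Q'.
  apply/setP=> j; rewrite !inE; have [-> | _] //= := eqVneq j i.
  by rewrite Bi Q'i.
have ltU' : #|fixed_coords_of B :\: Q'| < m.
  by apply: leq_trans leUm; rewrite UE cardsU1 !inE eqxx.
have [X pX loss] := piece_loss BA minB Q'i.
(* A member fixing i at b and nothing else outside Q would make b thick. *)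
have not_in_Q' H b : H \in B -> ~~ thick_value Q B b -> b \in factor H i ->
    ~~ (fixed_coords H \subset Q').
  move=> BH not_thick Hb; apply: contra not_thick => HQ'.
  case: (boolP (i \in fixed_coords H)) => [Hi | H'i]; last first.
    have /(span_sub minB BH)/subsetP/(_ i Bi) : fixed_coords H \subset Q.
      apply/subsetP=> j Hj; have /setU1P[ji | //] := subsetP HQ' j Hj.
      by rewrite ji (negbTE H'i) in Hj.
    by rewrite (negbTE Q'i).
  apply/exists_inP; exists H; rewrite // (factor_fixed Hi Hb) eqxx /=.
  rewrite setDDl setUC (_ : _ :\: _ = set0); last by apply/eqP; rewrite setD_eq0.
  rewrite big_set0; apply: leq_ltn_trans D_gt; by rewrite expn_gt0 K_gt0.
pose g (rho : hyperplane S -> S i) b :=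
  #|[set H in B | ~~ (fixed_coords H \subset Q') && (rho H == b)]|.
have [rho [rhoH fr] poor_big] : exists2 rho : hyperplane S -> S i,
    routed A K D e Q' B rho &
    (poor_values Q B i != set0) -> exists2 a, a \in poor_values Q B i & K <= g rho a.
  have [poor0 | /set0Pn[a Ma]] := eqVneq (poor_values Q B i) set0.
    have [rho ?] :=
      exists_route S_ge2 IH BA minB (subsetUr [set i] Q) (setU11 i Q) ltU'.
    by exists rho.
  have not_thick : ~~ thick_value Q B a by move: Ma; rewrite inE => /andP[].
  have xa : agree Q x (update x a).
    by apply/agreeP=> j Qj; rewrite update_off //; apply: contraNneq Q'i => <-.
  have [B1 minB1 B1B] :=
    minset_exists (covers_fiberS (subsetUr [set i] Q) xa (minsetp minB)).
  have B1Q' H : H \in B1 -> ~~ (fixed_coords H \subset Q').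
    move=> B1H; apply: not_in_Q' not_thick _; first exact: (subsetP B1B).
    by have := base_in_factor minB1 B1H (setU11 i Q); rewrite update_at.
  have leU : fixed_coords_of B1 \subset fixed_coords_of B.
    by apply/bigcupsP=> H /(subsetP B1B) BH; apply: (bigcup_sup H).
  have fr1 : frameable A K D e Q' (fixed_coords_of B1 :\: Q') (#|B1| - K).
    apply: IH (subset_trans B1B BA) minB1 _; apply: leq_ltn_trans ltU'.
    exact/subset_leq_card/setSD.
  have [|||rho2 routed2] := exists_route
    (Q := Q' :|: fixed_coords_of B1) (i := i) S_ge2 IH BA minB.
  - by apply: subset_trans (subsetUl _ _); apply: subsetUr.
  - by rewrite !inE eqxx.
  - apply: leq_ltn_trans ltU'; apply/subset_leq_card/setDS/subsetUl.
  have [rho routed_rho rho_a] :=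
    routed_step (setU11 i Q) B1B minB1 B1Q' fr1 routed2.
  exists rho => // _; exists a => //.
  apply: leq_trans (poor_fiber_large minB B1B Ui not_thick minB1) _.
  apply/subset_leq_card/subsetP=> H B1H; apply/setIdP; split; first exact: (subsetP B1B).
  by rewrite B1Q' //= rho_a // update_at.
pose p := #|popular_values Q B i| - (poor_values Q B i == set0).
have fr_i : frameable A K D e Q [set i] (K * p).
  apply: frameable1 pX _ poor_i; apply: leq_trans loss _.
  rewrite /p; have [-> | ] := eqVneq (poor_values Q B i) set0.
    by rewrite cards0; lia.
  by rewrite -card_gt0; lia.
rewrite UE; apply: frameable_leq (frameableU _ fr_i _); last first.
- by rewrite setUC; exact: fr.
- by rewrite disjoints1 !inE eqxx.
pose big_values := [set b | K <= g rho b].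
have sum_g : \sum_b g rho b <= #|B|.
  rewrite -sum1_card (partition_big rho predT) //=; apply: leq_sum => b _.
  rewrite sum1dep_card; apply/subset_leq_card/subsetP=> H; rewrite !inE.
  by case/and3P=> -> _ ->.
have := leq_trans (sum_sub_le (g rho) K) sum_g; rewrite -/big_values.
have pop_big : popular_values Q B i \subset big_values.
  apply/subsetP=> b; rewrite !inE => /andP[not_thick pop_b].
  apply: leq_trans pop_b _; apply/subset_leq_card/subsetP=> H /setIdP[BH /eqP Hb].
  have bH : b \in factor H i by rewrite Hb set11.
  apply/setIdP; split=> //; rewrite (not_in_Q' _ _ BH not_thick bH) /=.
  by rewrite -in_set1 -Hb.
have lt_big : p < #|big_values| \/ p = 0 /\ #|big_values| = 0.
  have le_big := subset_leq_card pop_big; rewrite /p.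
  have [_ | /poor_big[a Ma ga]] := eqVneq (poor_values Q B i) set0; first by lia.
  left; rewrite subn0; apply: proper_card; apply/properP; split=> //.
  exists a; rewrite inE //; move: Ma; rewrite !inE => /andP[_ lt_a].
  by rewrite leqNgt lt_a andbF.
have sum0 : #|big_values| = 0 -> \sum_b (g rho b - K) = 0.
  move/eqP; rewrite cards_eq0 => /eqP big0; apply: big1 => b _.
  have : b \notin big_values by rewrite big0 inE.
  by rewrite inE -ltnNge => /ltnW; rewrite -subn_eq0 => /eqP.
move: lt_big sum0; set sg := \sum_b _; set q := #|big_values|.
case=> [ltpq _ | [-> q0 /(_ q0)->]]; last by rewrite muln0.
by move=> le_B; have := leq_mul (leqnn K) ltpq; rewrite mulnS; lia.
Qed.

End Existence.

End Covers.

(** * From ordered lists to generalized frames *)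

Section FinalFrame.
Local Set Implicit Arguments.
Local Unset Strict Implicit.
Local Unset Printing Implicit Defensive.
Local Open Scope nat_scope.

Context {k : nat} {S : 'I_k -> finType}.
Hypothesis S_ge2 : forall i, 2 <= #|S i|.
Implicit Types (i j : 'I_k) (I Q : {set 'I_k}) (H : hyperplane S).

Lemma densityE (R : realType) I H :
  density R I H = ((\prod_(j in I :&: fixed_coords H) #|S j|)%:R^-1)%R.
Proof.
have S_gt0 j : 0 < #|S j| by exact: ltnW.
have projE : #|hyperplane_proj I H| = \prod_(j in I :\: fixed_coords H) #|S j|.
  rewrite cardsXn -(big_sub _ (fun j => #|factor H j|)).
  rewrite (big_setID (fixed_coords H)) /= big1 ?mul1n.
    apply: eq_bigr => j /setDP[_ H'j].
    by case: (factorP H j) => [->|]; rewrite ?cardsT // (negbTE H'j).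
  by move=> j /setIP[_]; rewrite inE => /eqP.
have spaceE : #|subspace (S := S) I| = \prod_(j in I) #|S j|.
  rewrite (big_sub _ (fun j => #|S j|)).
  have <- : #|setXn (fun j : {j | j \in I} => [set: S (val j)])| =
      #|subspace (S := S) I|.
    rewrite -cardsT; congr #|pred_of_set _|; apply/setP=> z; rewrite in_setXn inE.
    by apply/forallP=> j; rewrite inE.
  by rewrite cardsXn; apply: eq_bigr => j _; rewrite cardsT.
rewrite /density projE spaceE [X in (_ / X%:R)%R](big_setID (fixed_coords H)) /=.
rewrite natrM invfM mulrCA divff ?mulr1 // pnatr_eq0 -lt0n.
exact: prodn_gt0.
Qed.

(** The disjointness condition follows from the others: if H lies in F_i and F_j
with i before j, then H fixes j, which belongs to I(i), so the density of H is
at most 1 / |S_j|. *)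
Lemma generalized_frame_of_list (R : realType) (A : {set hyperplane S}) D l F :
  0 < D -> uniq l -> l =i [set: 'I_k] -> framed A D set0 l F ->
  generalized_frame (D%:R^-1 : R)%R F /\ forall i, F i \subset A.
Proof.
move=> D_gt0 Ul lT fl; have lP i : i \in l by rewrite lT inE.
have size_l : size l = k.
  by rewrite -(card_uniqP Ul) (eq_card lT) cardsT card_ord.
pose before i := [set j in take (index i l) l].
have beforeE i j : (j \in before i) = (index j l < index i l).
  by rewrite inE in_take.
have pieces i : frame_piece A D (before i) i (F i).
  by have := framed_piece fl (lP i); rewrite set0U.
have [s sP] := fin_all_exists (fun i => (pieces i).2).
pose I i := ~: (i |: before i).
have F_prod i H : H \in F i -> \prod_(j in I i :&: fixed_coords H) #|S j| < D.
  move=> /sP[_ _ _]; congr (_ < D); apply: eq_bigl => j.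
  by rewrite !inE negb_or; case: (j == i); case: (j \in _); rewrite ?andbF.
split; last by move=> i; apply/subsetP=> H /sP[].
split; first by move=> i; have [] := pieces i.
split.
  have lt_l (j : 'I_k) : j < size l by rewrite size_l.
  have nth_inj : injective (fun j : 'I_k => nth j l j).
    move=> i j /=; rewrite (set_nth_default i) // => /eqP.
    by rewrite nth_uniq // => /eqP/val_inj.
  have index_pi j : index (perm nth_inj j) l = j.
    by rewrite permE index_uniq // size_l.
  exists (perm nth_inj), I, (fun i j => s i j); split.
    move=> i j ltij; rewrite in_setC in_setU1 negb_or beforeE !index_pi -leqNgt.
    by rewrite (inj_eq perm_inj) -val_eqE /= gtn_eqF //= ltnW.
  move=> i H FH; have [AH Hi Hs _] := sP i H FH; split=> // [|j].
    rewrite densityE ltf_pV2 ?posrE ?ltr0n // ?ltr_nat ?F_prod //.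
    by apply: prodn_gt0 => j; exact: ltnW.
  rewrite in_setU1 in_setC negb_or negbK => /andP[ji]; rewrite in_setU1 (negbTE ji).
  move=> /= before_j.
  have := Hs j before_j.
  by case: (factorP H j) => [-> _ | Hj /(factor_fixed Hj)]; [right | left].
move=> i j ij; rewrite invrK ler_nat => le_D.
wlog lt_ij : i j ij le_D / index i l < index j l.
  move=> disj; have [lt_ij | lt_ji | E] := ltngtP (index i l) (index j l).
    exact: disj.
    by rewrite disjoint_sym; apply: disj; rewrite // 1?eq_sym // minnC.
  by case/eqP: ij; rewrite -(nth_index i (lP i)) E nth_index.
rewrite disjoints_subset; apply/subsetP=> H Fi; rewrite inE; apply/negP=> Fj.
have [_ Hj _ _] := sP j H Fj.
have : j \in I i :&: fixed_coords H.
  rewrite !(in_setI, in_setC, in_setU1) negb_or eq_sym ij beforeE -leqNgt Hj.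
  by rewrite ltnW.
move=> IHj; have := F_prod i H Fi; rewrite (bigD1 j IHj) /= ltnNge.
move/negP; apply; apply: leq_trans le_D _; apply: leq_trans (geq_minr _ _) _.
by apply: leq_pmulr; apply: prodn_cond_gt0 => t _; apply: ltnW.
Qed.

End FinalFrame.

Lemma expn43_bernoulli p : (3 ^ p * (3 + p) <= 3 * 4 ^ p)%N.
Proof. by elim: p => // p; rewrite !expnS; nia. Qed.

Theorem theorem2p3 (R : realType) (C eps : R) (C_gt0 : 0 < C) (eps_gt0 : 0 < eps) :
  exists delta : R, 0 < delta /\
    forall (k : nat) (S : 'I_k -> finType), (forall i, (2 <= #|S i|)%N) ->
    forall A : {set hyperplane S},
      is_minimal_cover A ->
      fixed_coords_of A = [set: 'I_k] ->
      #|A|%:R <= C * (\sum_(i < k) (#|S i| - 1))%N%:R ->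
      exists F : 'I_k -> {set hyperplane S},
        [/\ generalized_frame delta F,
            forall i, F i \subset A
          & (1 - eps) * (\sum_(i < k) (#|S i| - 1))%N%:R
              <= (\sum_(i < k) #|F i|)%N%:R].
Proof.
pose e := (Num.bound (2 / eps)).+1; pose K := (Num.bound (2 * C / eps)).+1.
have e_ge : 2 <= e%:R * eps.
  rewrite -ler_pdivrMr //; apply: le_trans (ltW (archi_boundP _)) _.
    by rewrite divr_ge0 // ltW.
  by rewrite ler_nat.
have K_ge : 2 * C <= K%:R * eps.
  rewrite -ler_pdivrMr //; apply: le_trans (ltW (archi_boundP _)) _.
    by rewrite divr_ge0 ?mulr_ge0 // ltW.
  by rewrite ler_nat.
(* The two factors of D serve the local lemma and small covers respectively. *)
pose n := (5 * e)%N; pose D := ((3 * K) ^ n.+1 * K ^ K + 1)%N.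
have n_large : (3 ^ n.+1 * e <= 2 * 4 ^ n)%N.
  have := expn43_bernoulli n; rewrite expnS {2}/n.
  by set u := (3 ^ n)%N; set v := (4 ^ n)%N; nia.
have KK_gt0 : (0 < K ^ K)%N by rewrite expn_gt0.
have D1 : ((3 * K) ^ n.+1 <= D)%N by rewrite /D; nia.
have D2 : (K ^ K < D)%N.
  have : (0 < (3 * K) ^ n.+1)%N by rewrite expn_gt0.
  by rewrite /D; nia.
exists D%:R^-1; split; first by rewrite invr_gt0 ltr0n /D addn1.
move=> k S S_ge2 A minA FA sizeA.
have S_pt i : exists b : S i, true.
  by have /card_gt0P[b _] := ltnW (S_ge2 i); exists b.
pose x : Defs.space S := [ffun i => xchoose (S_pt i)].
have min0 : minset (covers_fiber set0 x) A.
  have coverE B : covers_fiber set0 x B = is_cover B.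
    apply/covers_fiberP/eqP => [cov | cov z _].
      apply/setP=> z; rewrite inE; apply/bigcupP.
      by apply: cov; apply/agreeP=> j; rewrite inE.
    by apply/bigcupP; rewrite cov inE.
  case/andP: minA => covA /forallP minA; apply/minsetP; rewrite coverE.
  split=> // B; rewrite coverE => covB BA; apply/eqP; apply: contraT => neBA.
  by have := minA B; rewrite properEneq neBA BA covB.
have [l [F [Ul lT fl bnd]]] :=
  framing_below_all S_ge2 (isT : (0 < K)%N) D2 n_large D1 (subxx A) min0 (ltnSn _).
have lT' : l =i [set: 'I_k] by move=> i; rewrite lT FA setD0.
have [frame FA'] :=
  generalized_frame_of_list S_ge2 R (leq_ltn_trans (leq0n _) D2) Ul lT' fl.
exists F; split=> //.
have sum_l (f : 'I_k -> nat) : (\sum_(j <- l) f j = \sum_(j < k) f j)%N.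
  rewrite -big_enum; apply: perm_big; apply: uniq_perm; rewrite ?enum_uniq // => j.
  by rewrite lT' mem_enum inE.
have [size_F _] := frame.
rewrite !sum_l in bnd; set W := (\sum_(i < k) (#|S i| - 1))%N in sizeA bnd *.
set L := (\sum_(j < k) (#|S j| - 1 - #|F j|))%N in bnd.
have -> : (\sum_(i < k) #|F i| = W - L)%N.
  by rewrite -sumnB => [|i _]; rewrite ?leq_subr //; apply: eq_bigr => i _; rewrite subKn.
have LW : (L <= W)%N by apply: leq_sum => i _; apply: leq_subr.
have bndR : e%:R * K%:R * L%:R <= K%:R * W%:R + e%:R * #|A|%:R :> R.
  rewrite -!natrM -natrD ler_nat; apply: leq_trans bnd _.
  by rewrite leq_add2l leq_mul2l leq_subr orbT.
have W_ge0 : 0 <= W%:R :> R by [].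
have e_gt0 : 0 < e%:R :> R by rewrite ltr0n.
have K_gt0 : 0 < K%:R :> R by rewrite ltr0n.
suff : L%:R <= eps * W%:R by rewrite natrB //; lra.
rewrite -(ler_pM2l (mulr_gt0 e_gt0 K_gt0)).
have h1 : 2 * (K%:R * W%:R) <= e%:R * eps * (K%:R * W%:R).
  by rewrite ler_wpM2r // mulr_ge0.
have h2 : 2 * C * (e%:R * W%:R) <= K%:R * eps * (e%:R * W%:R).
  by rewrite ler_wpM2r // mulr_ge0.
have h3 : e%:R * #|A|%:R <= e%:R * (C * W%:R) by rewrite ler_wpM2l.
lra.
Qed.
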